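(* For every integer $t\ge 5$ there exists $N$ such that for all integers $n\ge N$ and $k\ge 1$ with $n-2k+2=t$, the Kneser graph $\mathrm{KG}(n,k)$ contains an odd topological $K_t$ subgraph.
   Context: For $n>2k$, the Kneser graph $\mathrm{KG}(n,k)$ has as vertices all $k$-element subsets of $\{1,\dots,n\}$, two being adjacent iff they are disjoint. A topological $K_r$ subgraph of a graph $G$ consists of $r$ distinct branching vertices together with $\binom r2$ paths in $G$, one connecting each pair of branching vertices, such that these paths are internally vertex-disjoint from each other and contain no branching vertices other than their endpoints. It is odd if each of these $\binom r2$ paths has an odd number of edges. *)

(* Defs.v *)
From mathcomp Require Import all_boot.

Set Implicit Arguments.
Unset Strict Implicit.
Unset Printing Implicit Defensive.

Definition kneser_vertex (n k : nat) : finType := {A : {set 'I_n} | #|A| == k}.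

(* [A != B] matters only for k = 0, where the empty set would be a loop. *)
Definition kneser (n k : nat) : rel (kneser_vertex n k) :=
  fun A B => (A != B) && [disjoint val A & val B].

Lemma kneser_sym n k : symmetric (@kneser n k).
Proof. by move=> A B; rewrite /kneser eq_sym disjoint_sym. Qed.

Lemma kneser_irrefl n k : irreflexive (@kneser n k).
Proof. by move=> A; rewrite /kneser eqxx. Qed.

Section TopologicalClique.

Variables (T : finType) (e : rel T).

(* A path from x to y is represented by the sequence s of its internal
   vertices; its vertex sequence is x :: rcons s y. *)
Definition graph_path (x : T) (s : seq T) (y : T) : bool :=
  path e x (rcons s y) && uniq (x :: rcons s y).

Definition path_length (s : seq T) : nat := (size s).+1.

(* Only the values P i j with i < j are used: one path for each unordered
   pair of branching vertices. *)
Record topological_clique (r : nat)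
    (b : 'I_r -> T) (P : 'I_r -> 'I_r -> seq T) : Prop := TopologicalClique {
  branch_inj : injective b;
  branch_path : forall i j : 'I_r, i < j -> graph_path (b i) (P i j) (b j);
  internally_disjoint : forall i j i' j' : 'I_r, i < j -> i' < j' ->
    (i, j) != (i', j') -> [disjoint P i j & P i' j'];
  branch_not_internal : forall i j m : 'I_r, i < j -> b m \notin P i j
}.

Definition has_odd_topological_clique (r : nat) : Prop :=
  exists (b : 'I_r -> T) (P : 'I_r -> 'I_r -> seq T),
    topological_clique b P /\
    forall i j : 'I_r, i < j -> odd (path_length (P i j)).

End TopologicalClique.

(* Main.v *)
Require Import Defs.
From mathcomp Require Import all_boot.
From mathcomp Require Import zify.

(** Take branching vertices [b i] that pairwise differ in at least about [k / t]
    elements, and build the paths one at a time, avoiding the [O(k)] vertices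
    used so far. From [b i] choose a fresh [A'] disjoint from [b j]; there are
    about [(k / t) ^ 2] pairwise disjoint paths of single swaps from [b i] to [A'],
    indexed by an element missing from and an element added to all their interior
    vertices, so one of them is free. Two vertices that differ by a swap have at
    least [C(k + 2, 2)] common neighbours (here [t >= 5] is used), so a common
    neighbour can be inserted greedily between consecutive vertices. This gives an
    even Kneser path from [b i] to [A'], and the edge from [A'] to [b j] makes it
    odd. *)

(** * Greedy assembly of the paths *)

(** At every stage the forbidden list consists of the [r] branching vertices and the interiors of at
    most [r * r] earlier paths, each with at most [D] vertices. An even number of interior vertices
    means an odd length. *)
Lemma greedy_odd_topological_clique (T : finType) (e : rel T) (r D : nat)
    (b : 'I_r -> T) :
  injective b ->
  (forall (i j : 'I_r) (F : seq T), i < j -> size F <= r + r * r * D ->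
     exists s, [/\ graph_path e (b i) s (b j), ~~ odd (size s), size s <= D
                 & {in s, forall x, x \notin F}]) ->
  has_odd_topological_clique e r.
Proof.
move=> b_inj linkP.
(* The induction runs over lists of ordered pairs; pairs with [p.1 >= p.2] are carried along without
   any constraint. *)
have greedy : forall ps : seq ('I_r * 'I_r), uniq ps ->
    size ps <= r * r -> exists P : 'I_r * 'I_r -> seq T,
    {in ps, forall p : 'I_r * 'I_r, p.1 < p.2 -> [/\ graph_path e (b p.1) (P p) (b p.2),
       ~~ odd (size (P p)), size (P p) <= D & forall m, b m \notin P p]} /\
    {in ps &, forall p q : 'I_r * 'I_r, p.1 < p.2 -> q.1 < q.2 -> p != q ->
       [disjoint P p & P q]}; last first.
- have [||P [PP Pdisj]] := greedy (enum {: 'I_r * 'I_r}).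
  + exact: enum_uniq.
  + by rewrite -cardE card_prod card_ord.
  have inE' p : p \in enum {: 'I_r * 'I_r} by rewrite mem_enum.
  exists b, (fun i j => P (i, j)); split; last first.
    by move=> i j ij; have [] := PP (i, j) (inE' _) ij.
  split=> //.
  + by move=> i j ij; have [] := PP (i, j) (inE' _) ij.
  + by move=> i j i' j' ij ij' ne; apply: (Pdisj (i, j) (i', j')).
  + by move=> i j m ij; have [_ _ _] := PP (i, j) (inE' _) ij.
elim=> [|p ps IH] /=; first by exists (fun=> [::]); split.
case/andP=> p_ps ps_uniq ps_size.
have [P [PP Pdisj]] := IH ps_uniq (ltnW ps_size).
case: (ltnP p.1 p.2) => [lt_p|le_p]; last first.
  have nlt : p.1 < p.2 = false by apply/negbTE; rewrite -leqNgt.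
  exists P; split=> [q|q q']; rewrite !inE.
    by case/predU1P=> [->|/PP//]; rewrite nlt.
  case/predU1P=> [->|q_ps]; first by rewrite nlt.
  by case/predU1P=> [->|q'_ps]; [rewrite nlt | apply: Pdisj].
pose used := flatten [seq P q | q : 'I_r * 'I_r <- ps & q.1 < q.2].
have used_size : size used <= size ps * D.
  rewrite /used size_flatten /shape -map_comp sumnE big_map big_filter.
  rewrite -sum1_size big_distrl /= big_mkcond /=.
  rewrite big_seq [leqRHS]big_seq; apply: leq_sum => q q_ps.
  by rewrite mul1n; case: ifP => // lt_q; have [] := PP q q_ps lt_q.
have [|s [s_path s_odd s_size sF]] := linkP p.1 p.2 (codom b ++ used) lt_p.
  rewrite size_cat size_codom card_ord leq_add2l (leq_trans used_size) //.
  by rewrite leq_mul2r (ltnW ps_size) orbT.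
have s_used q : q \in ps -> q.1 < q.2 -> [disjoint s & P q].
  move=> q_ps lt_q; rewrite disjoint_has; apply/hasPn => x /sF.
  rewrite mem_cat negb_or => /andP[_]; apply: contra => xq.
  by apply/flatten_mapP; exists q; rewrite // mem_filter lt_q.
exists (fun q => if q == p then s else P q); split=> [q|q q']; rewrite !inE.
  case/predU1P=> [->|q_ps] lt_q.
    rewrite eqxx; split=> // m; apply/negP => /sF.
    by rewrite mem_cat codom_f.
  by case: eqP => [qp|_]; [move: p_ps; rewrite -qp q_ps | apply: PP].
have neq q0 : q0 \in ps -> (q0 == p) = false.
  by move=> q0_ps; apply: contraNF p_ps => /eqP <-.
case/predU1P=> [->|q_ps]; case/predU1P=> [->|q'_ps] lt_q lt_q'; rewrite ?eqxx //.
- by rewrite (neq q') // => _; apply: s_used.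
- by rewrite (neq q) // disjoint_sym => _; apply: s_used.
- by rewrite !neq //; apply: Pdisj.
Qed.

(** * Swaps and fresh vertices *)

Section KneserLinks.

Variables n k : nat.
Local Notation V := (kneser_vertex n k).

(** Johnson graph adjacency with loops. The bound on the union directly bounds from below the
    complement in which common Kneser neighbours live. *)
Definition johnson : rel V := fun A B => #|val A :|: val B| <= k.+1.

Lemma card_kneser_vertex (A : V) : #|val A| = k.
Proof. exact/eqP/(valP A). Qed.

Lemma kneser_vertexP (A : {set 'I_n}) : #|A| = k -> exists B : V, val B = A.
Proof. by move/eqP=> Ak; exists (exist _ A Ak). Qed.

Lemma swap_vertex (A : V) x y : x \in val A -> y \notin val A ->
  exists B : V, val B = y |: (val A :\ x).
Proof.
move=> xA yA; apply: kneser_vertexP.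
rewrite cardsU1 !inE (negbTE yA) andbF /=.
by have := card_kneser_vertex A; rewrite (cardsD1 x) xA.
Qed.

Lemma johnson_swap (A B : V) x y : val B = y |: (val A :\ x) -> johnson A B.
Proof.
rewrite /johnson => ->; have := leq_card_setU [set y] (val A).
rewrite cards1 card_kneser_vertex; apply: leq_trans; apply: subset_leq_card.
apply/subsetP=> z; rewrite !inE.
by case: (z \in val A); rewrite ?orbT //= andbF orbF.
Qed.

Lemma johnson_sym : symmetric johnson.
Proof. by move=> A B; rewrite /johnson setUC. Qed.

(** A set of at least [k + 2] elements has at least ['C(k + 2, k) = 'C(k + 2, 2)] subsets of size
    [k], too many for all of them to lie in [F]. *)
Lemma fresh_vertex (W : {set 'I_n}) (F : seq V) :
  k.+2 <= #|W| -> size F < 'C(k.+2, 2) ->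
  exists2 A : V, A \notin F & val A \subset W.
Proof.
move=> Wk Fk.
pose S := [set A : V | val A \subset W].
have [A AS AF] : exists2 A, A \in S & A \notin F.
  apply/exists_inP; apply: contraLR Fk; rewrite negb_exists_in => /forall_inP SF.
  rewrite -leqNgt (leq_trans _ (card_size F)) //.
  have -> : 'C(k.+2, 2) = 'C(k.+2, k).
    by rewrite -(@bin_sub k.+2 2) // !subSS subn0.
  apply: (@leq_trans 'C(#|W|, k)).
    exact: leq_bin2l.
  rewrite -cards_draws.
  apply: (@leq_trans #|[set val A | A in S]|).
    apply: subset_leq_card; apply/subsetP=> B; rewrite inE => /andP[BW /eqP Bk].
    have [A eA] := kneser_vertexP _ Bk.
    by apply/imsetP; exists A; rewrite ?inE eA.
  apply: leq_trans (leq_imset_card _ _) _.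
  by apply: subset_leq_card; apply/subsetP=> A /SF; rewrite negbK.
by exists A; move: AS; rewrite ?inE.
Qed.


(** * Paths of swaps *)

(** Each step trades an element of [A :\: B] for one of [B :\: A]. Confining the path between
    intersection and union is what later keeps paths with different traces apart. *)
Lemma johnson_geodesic (A B : V) : exists l : seq V,
  [/\ path johnson A l, last A l = B, uniq (A :: l), size l = #|val A :\: val B|
    & {in A :: l, forall C : V, val A :&: val B \subset val C
                              /\ val C \subset val A :|: val B}].
Proof.
have [d] := ubnP #|val A :\: val B|; elim: d A => // d IH A ltd.
have cardD : #|val A :\: val B| = #|val B :\: val A|.
  by rewrite !cardsD (setIC (val B)) !card_kneser_vertex.
have [D0 | [x]] := set_0Vmem (val A :\: val B).
  have eAB : A = B.
    apply/val_inj/eqP; rewrite eqEcard !card_kneser_vertex leqnn andbT.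
    by rewrite -setD_eq0 D0.
  exists [::]; rewrite D0 cards0 eAB; split=> // C; rewrite inE => /eqP ->.
  by rewrite setIid setUid subxx.
move=> xD; have /card_gt0P[y] : 0 < #|val B :\: val A|.
  by rewrite -cardD; apply/card_gt0P; exists x.
move: (xD); rewrite !inE => /andP[xB xA] /andP[yA yB].
have [A1 eA1] := swap_vertex _ _ _ xA yA.
have eD : val A1 :\: val B = (val A :\: val B) :\ x.
  apply/setP=> z; rewrite eA1 !inE; case: eqP => [->|_] /=.
    by rewrite yB andbF.
  by rewrite andbCA.
have cD : #|val A :\: val B| = #|val A1 :\: val B|.+1.
  by rewrite eD (cardsD1 x) xD.
have [|l [pl ll ul sl bl]] := IH A1; first by rewrite -ltnS -cD.
have subI : val A :&: val B \subset val A1 :&: val B.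
  apply/subsetP=> z; rewrite eA1 !inE => /andP[zA zB]; rewrite zA zB !andbT.
  by apply/orP; right; apply: contraNneq xB => <-.
have subU : val A1 :|: val B \subset val A :|: val B.
  apply/subsetP=> z; rewrite eA1 !inE; case: eqP => [->|_] /=.
    by rewrite yB orbT.
  by case/orP=> [/andP[_ ->]|->]; rewrite ?orbT.
exists (A1 :: l); split=> //.
- by rewrite /= pl andbT; apply: johnson_swap eA1.
(* The element [x] of [A] lies in neither [A1] nor [B], hence in no later vertex, so [A] does not
   recur. *)
- rewrite cons_uniq ul andbT; apply/negP => /bl[_ /subsetP/(_ x xA)].
  by rewrite eA1 !inE eqxx (negbTE xB) orbF /= orbF => /eqP xy; rewrite -xy xA in yA.
- by rewrite /= sl cD.
move=> C; rewrite inE => /predU1P[->|/bl[subC Csub]].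
  by rewrite subsetIl subsetUl.
by split; [apply: subset_trans subC | apply: subset_trans subU].
Qed.

Lemma johnson_avoiding (A B : V) (F : seq V) : A != B ->
  size F < #|val A :&: val B| * #|~: (val A :|: val B)| ->
  exists l : seq V, [/\ path johnson A l, last A l = B, uniq (A :: l),
    size l <= k.+2 & {in l, forall C, C != B -> C \notin F}].
Proof.
move=> neAB ltF.
(* A vertex missing exactly [x] from [A :&: B] and containing exactly [y]
   outside [A :|: B] has trace [([set x], [set y])]; the corresponding paths
   are disjoint for distinct [(x, y)]. *)
pose trace (C : V) := ((val A :&: val B) :\: val C, val C :\: (val A :|: val B)).
pose M := setX (val A :&: val B) (~: (val A :|: val B)).
have [[x y]] : exists2 p, p \in M & ([set p.1], [set p.2]) \notin map trace F.
  apply/exists_inP; apply: contraLR ltF; rewrite negb_exists_in => /forall_inP MF.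
  rewrite -leqNgt -cardsX -/M -(size_map trace).
  apply: leq_trans (card_size _).
  rewrite -(@card_imset _ _ (fun p : 'I_n * 'I_n => ([set p.1], [set p.2]))).
    apply: subset_leq_card; apply/subsetP=> _ /imsetP[p pM ->].
    by have := MF p pM; rewrite negbK.
  by move=> [a b] [c d] [] /= /set1_inj -> /set1_inj ->.
rewrite !inE negb_or /= => /andP[/andP[xA xB] /andP[yA yB]] xyF.
(* The same swap of [x] for [y] is made in [A] and in [B]; a geodesic between the results keeps
   lacking [x] and containing [y]. *)
have [A1 eA1] := swap_vertex _ _ _ xA yA.
have [B1 eB1] := swap_vertex _ _ _ xB yB.
have [l [pl ll ul sl bl]] := johnson_geodesic A1 B1.
have traceE C : C \in A1 :: l -> trace C = ([set x], [set y]).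
  move=> /bl[]; rewrite eA1 eB1 => /subsetP subC /subsetP Csub.
  congr pair; apply/setP=> z; rewrite !inE.
    have [->|nzx] := eqVneq z x.
      rewrite xA xB !andbT; apply/negP => /Csub; rewrite !inE eqxx /= !orbF orbb.
      by move=> /eqP xy; rewrite -xy xA in yA.
    apply/negbTE/negP => /andP[zC /andP[zA zB]].
    by case/negP: zC; apply: subC; rewrite !inE nzx zA zB !orbT.
  have [->|nzy] := eqVneq z y.
    by rewrite (negbTE yA) (negbTE yB) /=; apply: subC; rewrite !inE eqxx.
  apply/negbTE/negP => /andP[zAB /Csub].
  rewrite !inE (negbTE nzy) /=.
  by move: zAB; rewrite negb_or => /andP[/negbTE-> /negbTE->]; rewrite andbF.
have ytrace C : C \in A1 :: l -> y \in val C.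
  move=> /traceE[_ /setP/(_ y)]; rewrite !inE eqxx.
  by case/andP.
exists (A1 :: rcons l B); split.
- rewrite /= rcons_path pl ll (johnson_swap _ _ _ _ eA1) johnson_sym.
  by rewrite (johnson_swap _ _ _ _ eB1).
- by rewrite /= last_rcons.
- rewrite cons_uniq -rcons_cons mem_rcons in_cons negb_or neAB (contra (@ytrace A)) //.
  change (uniq (rcons (A1 :: l) B)).
  by rewrite (rcons_uniq (A1 :: l)) ul (contra (@ytrace B)).
- rewrite /= size_rcons sl !ltnS -[leqRHS](card_kneser_vertex A1).
  by rewrite subset_leq_card // subsetDl.
move=> C; rewrite -rcons_cons mem_rcons inE => /predU1P[->|/traceE tC _].
  by rewrite eqxx.
by apply: contra xyF => CF; rewrite -tC map_f.
Qed.

(** * From swap paths to Kneser paths *)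

(** The complement of the union of two consecutive vertices has at least [n - k - 1 >= k + 2]
    elements, and its [k]-subsets are common neighbours. Each inserted vertex joins [F], while [l]
    gets one shorter, so the bound on the sum persists. *)
Lemma fill_johnson_path (A : V) (l F : seq V) : 0 < k -> 2 * k + 3 <= n ->
  path johnson A l -> size F + size l <= 'C(k.+2, 2) ->
  exists s m : seq V, [/\ path (@kneser n k) A s, last A s = last A l,
    perm_eq s (l ++ m), size m = size l &
    uniq m /\ {in m, forall B, B \notin F}].
Proof.
move=> k_gt0 kn; elim: l A F => [|C l IH] A F /=.
  by exists [::], [::]; split.
move=> /andP[AC pl] szF.
have [||B BF BAC] := fresh_vertex (~: (val A :|: val C)) F.
- by rewrite cardsCs setCK card_ord (leq_trans _ (leq_sub2l n AC)) //; lia.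
- by apply: leq_trans szF; rewrite addnS ltnS leq_addr.
have adjB (D : V) : D \in [:: A; C] -> kneser D B.
  move=> DAC; have DB : [disjoint val D & val B].
    rewrite -setI_eq0 -subset0; apply/subsetP=> z; rewrite !inE => /andP[zD zB].
    move/subsetP/(_ z zB): BAC; rewrite !inE negb_or.
    by move: DAC; rewrite !inE => /orP[]/eqP<-; rewrite zD // andbF.
  rewrite /kneser DB andbT; apply: contraTneq DB => ->.
  by rewrite -setI_eq0 setIid -cards_eq0 card_kneser_vertex -lt0n.
have [|s [m [ps ls pm sm [um mF]]]] := IH C (B :: F) pl.
  by rewrite /= addSnnS.
exists (B :: C :: s), (B :: m); split=> /=; rewrite ?ls ?sm //.
- by rewrite ps (kneser_sym B) !adjB // !inE eqxx ?orbT.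
- by rewrite perm_sym -cat_cons (perm_catCA (C :: l) [:: B]) /= !perm_cons perm_sym.
split; first by rewrite um andbT; apply/negP => /mF; rewrite inE eqxx.
move=> D; rewrite inE => /predU1P[->//|/mF].
by rewrite inE negb_or => /andP[].
Qed.

Lemma kneser_odd_link (A B : V) (F : seq V) (p : nat) :
  0 < k -> 2 * k + 3 <= n -> p + (n - 2 * k) <= #|val A :\: val B| ->
  size F + k + 2 < p * p -> size F + 2 * k + 6 < 'C(k.+2, 2) ->
  exists s, [/\ graph_path (@kneser n k) A s B, ~~ odd (size s),
    size s <= 2 * k + 4 & {in s, forall C, C \notin F}].
Proof.
move=> k_gt0 kn pAB Fp Fk.
have szE : size (A :: B :: F) = (size F).+2 by [].
have [||A' A'F A'B] := fresh_vertex (~: val B) (A :: B :: F).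
- by rewrite cardsCs setCK card_ord card_kneser_vertex; lia.
- by rewrite szE; lia.
move: A'F; rewrite !inE !negb_or => /and3P[A'A neA'B A'F].
(* [A'] omits only [n - 2 * k] elements of the complement of [B], so it meets [A :\: B] in at least
   [p] elements. *)
have pI : p <= #|val A :&: val A'|.
  have sub : val A :\: val B \subset
      (val A :&: val A') :|: (~: val B :\: val A').
    by apply/subsetP=> z; rewrite !inE => /andP[-> ->]; case: (z \in _).
  have := leq_trans (subset_leq_card sub) (leq_card_setU _ _).
  rewrite (cardsDS A'B) (cardsCs (~: val B)) setCK card_ord !card_kneser_vertex; lia.
have pU : p <= #|~: (val A :|: val A')|.
  apply: leq_trans pI _; rewrite (cardsCs (~: _)) setCK card_ord cardsU !card_kneser_vertex.
  have := subset_leq_card (subsetIl (val A) (val A')); rewrite card_kneser_vertex.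
  by lia.
have [||l [pl ll ul sl lF]] := johnson_avoiding A A' (A :: B :: F).
- by rewrite eq_sym.
- by apply: leq_trans (leq_mul pI pU); rewrite szE; lia.
have {}lF : {in l, forall C, C \notin A :: B :: F}.
  move=> C Cl; have [->|/lF->//] := eqVneq C A'.
  by rewrite !inE !negb_or A'A neA'B.
(* Forbidding [l] itself keeps the inserted vertices off the swap path. The list [s] ends with [A'],
   which is adjacent to [B]. *)
have [|s [m [ps ls pm sm [um mF]]]] :=
    fill_johnson_path A l (l ++ A :: B :: F) k_gt0 kn pl.
  by rewrite size_cat szE; lia.
have sF : {in s, forall C, C \notin A :: B :: F}.
  move=> C; rewrite (perm_mem pm) mem_cat => /orP[/lF//|/mF].
  by rewrite mem_cat negb_or => /andP[].
have us : uniq s.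
  rewrite (perm_uniq pm) cat_uniq um andbT; move: ul => /= /andP[_ ->] /=.
  by apply/hasPn=> C /mF; rewrite mem_cat negb_or => /andP[].
have szs : size s = 2 * size l by rewrite (perm_size pm) size_cat sm addnn mul2n.
exists s; split; last by move=> C /sF; rewrite !inE !negb_or => /and3P[].
- rewrite /graph_path rcons_path ps ls ll /= /kneser neA'B disjoints_subset A'B.
  rewrite mem_rcons rcons_uniq us andbT inE negb_or.
  have AB : A != B.
    by apply/eqP=> eAB; move: pAB; rewrite eAB setDv cards0; clear -kn; lia.
  have notin (C : V) : C \in [:: A; B] -> C \notin s.
    move=> CAB; apply/negP => /sF; rewrite !inE !negb_or.
    by move: CAB; rewrite !inE => /orP[]/eqP->; rewrite eqxx //= andbF.
  by rewrite AB !notin // !inE eqxx ?orbT.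
- by rewrite szs oddM.
- by rewrite szs -(mulnDr 2 k 2) leq_mul2l addn2.
Qed.

(** * Well-separated branching vertices *)

Lemma card_ord_interval (a b : nat) :
  b <= n -> #|[set x : 'I_n | a <= x < b]| = b - a.
Proof.
move=> bn; rewrite -sum1dep_card -[RHS]muln1 -sum_nat_const_nat (big_nat_widen _ _ n) //.
by rewrite big_geq_mkord; apply: eq_bigl => x; rewrite andbC.
Qed.

(** The [i]-th vertex is a private block [D i] of [q] elements together with a common core [R] of
    [k - q] elements placed after all blocks. *)
Lemma spread_vertices (t q : nat) : t * q <= k -> 2 * k <= n ->
  exists b : 'I_t -> V, forall i j, i != j -> q <= #|val (b i) :\: val (b j)|.
Proof.
move=> tqk kn.
pose D (i : 'I_t) := [set x : 'I_n | i * q <= x < i.+1 * q].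
pose R := [set x : 'I_n | t * q <= x < t * q + (k - q)].
have Dt (i : 'I_t) : i.+1 * q <= t * q by rewrite leq_mul2r ltn_ord orbT.
have cardD i : #|D i| = q.
  by have Di := Dt i; rewrite card_ord_interval ?mulSn; lia.
have DR i : [disjoint D i & R].
  rewrite -setI_eq0 -subset0; apply/subsetP=> x; rewrite !inE.
  by have := Dt i; lia.
have cardDR i : #|D i :|: R| = k.
  have Di := Dt i; move: (DR i); rewrite -setI_eq0 => /eqP DR0.
  by rewrite cardsU DR0 cards0 cardD card_ord_interval; lia.
exists (fun i => exist _ (D i :|: R) (introT eqP (cardDR i))) => i j neij /=.
rewrite -(cardD i); apply/subset_leq_card/subsetP=> x Dx.
rewrite !inE negb_or; move/disjointFr: (DR i) => /(_ x Dx); rewrite !inE => ->.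
move: Dx; rewrite !inE => Dx; rewrite Dx /= !andbT.
apply: contraNN neij => Dx'; apply/eqP/val_inj => /=.
have ltD (a c : nat) : a * q <= x -> x < c.+1 * q -> a <= c.
  by move=> ax xc; rewrite leqNgt; apply/negP => /leq_mul/(_ (leqnn q)); lia.
by apply/eqP; rewrite eqn_leq; apply/andP; split; apply: ltD; lia.
Qed.

End KneserLinks.

(** * Choice of parameters *)

Theorem theorem4 : forall t : nat, 5 <= t ->
  exists N : nat, forall n k : nat,
    N <= n -> 1 <= k -> 2 * k < n -> n - 2 * k + 2 = t ->
    has_odd_topological_clique (@kneser n k) t.
Proof.
(* With [p] about [k / t], the inequality [p * p > 2 * t ^ 2 * k] needs [k] of order [t ^ 4]. *)
move=> t t5; exists (200 * t ^ 4) => n k Nn k_gt0 kn nkt.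
have eN : t ^ 4 = t * (t * (t * t)) by rewrite !expnS expn0 muln1.
pose q := k %/ t.
have tq : t * q <= k by rewrite mulnC leq_trunc_div.
have kq : k < t * q.+1 by rewrite mulnC ltn_ceil //; lia.
have [b bq] := spread_vertices n k t q tq (ltnW kn).
have t_le : t <= t * (t * (t * t)) by rewrite leq_pmulr // !muln_gt0; lia.
have k_big : 90 * (t * (t * (t * t))) <= k by lia.
have t3 : 25 * t <= t * (t * t) by rewrite mulnC leq_mul2l; nia.
have q_big : 90 * (t * (t * t)) <= q.
  rewrite leqNgt; apply/negP => lt_q.
  by have := leq_mul (leqnn t) lt_q; lia.
(* Subtracting [t] covers the loss [n - 2 * k = t - 2] in [kneser_odd_link]. *)
have [p eq_p] : exists p, q = p + t by exists (q - t); lia.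
have binE : 'C(k.+2, 2) * 2 = k.+2 * k.+1.
  by rewrite mulnC -mul_bin_diag bin1.
clearbody q; subst q.
have t2 : 25 <= t * t by exact: (leq_mul t5 t5).
have pp : t + t * t * (2 * k + 4) + k + 2 < p * p.
  have p_big : 89 * (t * (t * t)) <= p by lia.
  have := leq_mul p_big (leqnn p).
  have := leq_mul (leqnn (t * t)) kq.
  have := leq_mul (leqnn (t * t)) p_big.
  have := leq_mul t3 (leqnn p).
  have := leq_mul (leqnn t) p_big.
  have := leq_mul t2 (leqnn (t * t)).
  nia.
have kk : t + t * t * (2 * k + 4) + 2 * k + 6 < 'C(k.+2, 2).
  have k_big2 : 90 * (t * t) <= k by nia.
  have := leq_mul k_big2 (leqnn k).
  have := leq_mul t2 (leqnn k).
  nia.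
apply: (@greedy_odd_topological_clique _ _ _ (2 * k + 4) b) => [i j eij|i j F ij szF].
  by apply/eqP; apply: contraT => /bq; rewrite eij setDv cards0; lia.
apply: (@kneser_odd_link _ _ (b i) (b j) F p) => //; try lia.
have := bq i j; rewrite -val_eqE /=; lia.
Qed.
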